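(* Let $P$ be a message-transmission protocol with associated set of global states $S_P$, let $\mathcal{M}$ be the set of all messages that could be sent, and for $m\in\mathcal{M}$ let $G(m)\subseteq S_P$ be the set of global states where agent $1$ sends message $m$ to agent $2$. Then $P$ preserves message secrecy, i.e. for all $s\in S_P$ and all $m\in\mathcal{M}$ we have $\mathcal{K}^{dy}(s)\cap G(m)\neq\emptyset$, if and only if for every interpretation $\pi$ and every formula $\phi$: if $\phi$ depends only on the message exchanged by $P$ and $\phi$ is nontrivial in $M=(S_P,\mathcal{K}^{dy},\pi)$, then $M\models\neg K\phi$.
   Context: Epistemic logic: fix a set $\Phi_0$ of primitive propositions; formulas are built from $\Phi_0$ by $\neg$, $\wedge$ and $K$ (''the adversary knows''). An epistemic structure is $M=(W,\mathcal{K},\pi)$ with $W$ a set of worlds, $\mathcal{K}\subseteq W\times W$, $\mathcal{K}(w)=\{w'\mid (w,w')\in\mathcal{K}\}$, and $\pi$ (an interpretation) assigning to each world the set of primitive propositions true there. Truth: $(M,w)\models p$ iff $p\in\pi(w)$; $(M,w)\models\neg\phi$ iff not $(M,w)\models\phi$; $(M,w)\models\phi\wedge\psi$ iff both hold; $(M,w)\models K\phi$ iff $(M,w')\models\phi$ for all $w'\in\mathcal{K}(w)$. $M\models\phi$ means $(M,w)\models\phi$ for all $w\in W$. A formula $\phi$ is nontrivial in $M$ if there are $s,s'$ with $(M,s)\models\phi$ and $(M,s')\models\neg\phi$. Setting: global states are tuples $(s_e,s_{adv},s_1,\dots,s_n)$ of local states of the environment, the adversary and agents $1,\dots,n$. A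 message-transmission protocol is one whose goal is for agent $1$ to send a message confidentially to agent $2$; the adversary can intercept, forward and inject messages. $S_P$ is the set of global states the protocol goes through on execution (including those resulting from adversary actions), and includes states for all possible messages that could be sent. The adversary's local state $s_{adv}$ is a set of messages (intercepted messages plus initial messages such as public keys). Messages are symbolic: built from plaintexts $p$ and keys $k$ by pairing $(m_1,m_2)$ and encryption $\{m\}_k$; $k^{-1}$ denotes the inverse (decryption) key of $k$. The relation $H\vdash m$ (for a set $H$ of messages) is the least relation closed under: $m\in H$ implies $H\vdash m$; $H\vdash\{m\}_k$ and $H\vdash k^{-1}$ imply $H\vdash m$; $H\vdash(m_1,m_2)$ implies $H\vdash m_1$ and $H\vdash m_2$. For a set of keys $K$ define $\lfloor p\rfloor_K=p$, $\lfloor k\rfloor_K=k$, $\lfloor(m_1,m_2)\rfloor_K=(\lfloor m_1\rfloor_K,\lfloor m_2\rfloor_K)$, $\lfloor\{m\}_k\rfloor_K=\{\lfloor m\rfloor_K\}_k$ if $k^{-1}\in K$ and $=\square$ (a fixed blank symbol) otherwise; $\lfloor H\rfloor_K=\{\lfloor m\rfloor_K\mid m\in H\}$. Let $\mathrm{Keys}(H)=\{k\mid H\vdash k\}$. The relation $\mathcal{K}^{dy}$ on $S_P$: $(s,s')\in\mathcal{K}^{dy}$ iff $\lfloor s_{adv}\rfloor_{\mathrm{Keys}(s_{adv})}=\lfloor s'_{adv}\rfloor_{\mathrm{Keys}(s'_{adv})}$. A formula $\phi$ depends only on the message exchanged by the protocol (in $M$) if $(M,s)\models\phi$ iff $(M,s')\models\phi$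 whenever the same message is exchanged in states $s$ and $s'$.
   Formalization: It is assumed that in every global state of S_P agent 1 sends exactly one message to agent 2 (so ''the message exchanged'' is well defined; without this the equivalence can fail), and that there is at least one primitive proposition. *)

(* Defs.v *)
From mathcomp Require Import all_boot.
From mathcomp Require Import boolp classical_sets.

Set Implicit Arguments.
Unset Strict Implicit.
Unset Printing Implicit Defensive.

Local Open Scope classical_set_scope.

Inductive formula (Phi0 : Type) : Type :=
| Prim of Phi0
| Neg of formula Phi0
| And of formula Phi0 & formula Phi0
| Know of formula Phi0.

Record estructure (Phi0 : Type) := EStructure {
  world : Type;
  access : set (world * world);
  interp : world -> set Phi0
}.

Definition accessible {W : Type} (K : set (W * W)) (w : W) : set W :=
  [set w' | K (w, w')].

Fixpoint sat {Phi0 : Type} (M : estructure Phi0) (w : world M)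
    (phi : formula Phi0) : Prop :=
  match phi with
  | Prim p => interp w p
  | Neg psi => ~ sat w psi
  | And psi1 psi2 => sat w psi1 /\ sat w psi2
  | Know psi => forall w', accessible (@access _ M) w w' -> sat w' psi
  end.

Definition valid {Phi0 : Type} (M : estructure Phi0) (phi : formula Phi0) :=
  forall w : world M, sat w phi.

Definition nontrivial {Phi0 : Type} (M : estructure Phi0)
    (phi : formula Phi0) :=
  exists s s' : world M, sat s phi /\ sat s' (Neg phi).

Inductive message (Plain Key : Type) : Type :=
| MPlain of Plain
| MKey of Key
| MPair of message Plain Key & message Plain Key
| MEnc of message Plain Key & Key.

(** The values of the masking function: messages in which subterms may have
    been replaced by the blank symbol. *)
Inductive pattern (Plain Key : Type) : Type :=
| PPlain of Plain
| PKey of Key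
| PPair of pattern Plain Key & pattern Plain Key
| PEnc of pattern Plain Key & Key
| PBlank.

Arguments MPlain {Plain Key} _.
Arguments MKey {Plain Key} _.
Arguments PPlain {Plain Key} _.
Arguments PKey {Plain Key} _.
Arguments PBlank {Plain Key}.

(** [inv k] is the decryption key of [k]; it may be [k] itself (symmetric
    encryption) or a different key (public-key encryption). *)
Inductive derives {Plain Key : Type} (inv : Key -> Key)
    (H : set (message Plain Key)) : message Plain Key -> Prop :=
| derives_in m : H m -> derives inv H m
| derives_dec m k :
    derives inv H (MEnc m k) -> derives inv H (MKey (inv k)) ->
    derives inv H m
| derives_fst m1 m2 : derives inv H (MPair m1 m2) -> derives inv H m1
| derives_snd m1 m2 : derives inv H (MPair m1 m2) -> derives inv H m2.

Definition Keys {Plain Key : Type} (inv : Key -> Key)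
    (H : set (message Plain Key)) : set Key :=
  [set k | derives inv H (MKey k)].

Fixpoint mask {Plain Key : Type} (inv : Key -> Key) (K : set Key)
    (m : message Plain Key) : pattern Plain Key :=
  match m with
  | MPlain p => PPlain p
  | MKey k => PKey k
  | MPair m1 m2 => PPair (mask inv K m1) (mask inv K m2)
  | MEnc m1 k => if inv k \in K then PEnc (mask inv K m1) k else PBlank
  end.

Definition mask_set {Plain Key : Type} (inv : Key -> Key) (K : set Key)
    (H : set (message Plain Key)) : set (pattern Plain Key) :=
  [set mask inv K m | m in H].

(** There are [n.+2] agents, so that agents 1 and 2 always exist. *)
Record gstate (Plain Key : Type) (n : nat) (Env : Type)
    (Loc : 'I_n.+2 -> Type) := GState {
  env_state : Env;
  adv_state : set (message Plain Key);
  agent_state : forall i : 'I_n.+2, Loc i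
}.

Definition agent1 {n : nat} : 'I_n.+2 := Ordinal (isT : 0 < n.+2).
Definition agent2 {n : nat} : 'I_n.+2 := Ordinal (isT : 1 < n.+2).

(** [sends s i j m] says that [s] is a state of an execution in which agent [i]
    sends [m] to agent [j].  Speaking of "the" message exchanged in a state
    presupposes [exchanged_unique]: to every state of the protocol there
    corresponds exactly one message from agent 1 to agent 2.  The forward
    direction of [messagesP] says that the states cover all messages that could
    be sent. *)
Record protocol (Plain Key : Type) (n : nat) (Env : Type)
    (Loc : 'I_n.+2 -> Type) := Protocol {
  states : set (gstate Plain Key Env Loc);
  messages : set (message Plain Key);
  sends : gstate Plain Key Env Loc -> 'I_n.+2 -> 'I_n.+2 ->
    set (message Plain Key);
  exchanged_unique :
    forall s, states s -> exists! m, sends s agent1 agent2 m;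
  messagesP :
    forall m, messages m <-> exists2 s, states s & sends s agent1 agent2 m
}.

(** The worlds are the elements of the subtype associated with [states P]. *)

Definition sent_states {Plain Key : Type} {n : nat} {Env : Type}
    {Loc : 'I_n.+2 -> Type} (P : protocol Plain Key Env Loc)
    (m : message Plain Key) : set (states P) :=
  [set s | sends P (val s) agent1 agent2 m].

Arguments sent_states {Plain Key n Env Loc} P m _.

Definition Kdy {Plain Key : Type} (inv : Key -> Key) {n : nat} {Env : Type}
    {Loc : 'I_n.+2 -> Type} (P : protocol Plain Key Env Loc) :
    set (states P * states P) :=
  [set ss | let H := adv_state (val ss.1) in
            let H' := adv_state (val ss.2) in
            mask_set inv (Keys inv H) H = mask_set inv (Keys inv H') H'].

Arguments Kdy {Plain Key} inv {n Env Loc} P _.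

Definition Mdy {Plain Key : Type} (inv : Key -> Key) {n : nat} {Env : Type}
    {Loc : 'I_n.+2 -> Type} (P : protocol Plain Key Env Loc) {Phi0 : Type}
    (pi : states P -> set Phi0) : estructure Phi0 :=
  EStructure (Kdy inv P) pi.

Definition preserves_message_secrecy {Plain Key : Type} (inv : Key -> Key)
    {n : nat} {Env : Type} {Loc : 'I_n.+2 -> Type}
    (P : protocol Plain Key Env Loc) : Prop :=
  forall (s : states P) (m : message Plain Key), messages P m ->
    accessible (Kdy inv P) s `&` sent_states P m !=set0.

Definition depends_only_on_message {Plain Key : Type} (inv : Key -> Key)
    {n : nat} {Env : Type} {Loc : 'I_n.+2 -> Type}
    (P : protocol Plain Key Env Loc) {Phi0 : Type}
    (pi : states P -> set Phi0) (phi : formula Phi0) : Prop :=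
  forall (s s' : states P) (m : message Plain Key),
    sent_states P m s -> sent_states P m s' ->
    (@sat _ (Mdy inv pi) s phi <-> @sat _ (Mdy inv pi) s' phi).

(* Main.v *)
Require Import Defs.
From mathcomp Require Import all_boot.
From mathcomp Require Import boolp classical_sets.

(** Secrecy implies the formula condition: a state [t] refuting [phi] exchanges
    some message [m], secrecy yields a state in [G(m)] accessible from any given
    state, and [phi], depending only on the message, fails there too.
    Conversely, if no state of [G(m)] is accessible from [s], then interpret a
    primitive proposition as "[m] is not the message exchanged": it depends only
    on the message, is false on [G(m)], and is known at [s], hence true there
    by reflexivity of [Kdy]. *)

Theorem theorem2 (Phi0 : Type) (Phi0_inh : inhabited Phi0)
    (Plain Key : Type) (inv : Key -> Key)
    (n : nat) (Env : Type) (Loc : 'I_n.+2 -> Type)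
    (P : protocol Plain Key Env Loc) :
  preserves_message_secrecy inv P <->
  (forall (pi : states P -> set Phi0) (phi : formula Phi0),
     depends_only_on_message inv pi phi ->
     nontrivial (Mdy inv pi) phi ->
     valid (Mdy inv pi) (Neg (Know phi))).
Proof.
split=> [secr pi phi dep [_ [t [_ t_phi]]] w Kphi|secr s m mP].
  have tP := set_valP t.
  have [m [tm _]] := exchanged_unique tP.
  have mP : messages P m by apply/messagesP; exists (val t).
  have [w' [ww' w'm]] := secr w m mP.
  exact: t_phi (proj1 (dep w' t m w'm tm) (Kphi w' ww')).
have [p] := Phi0_inh.
apply: contrapT => Ksm.
have unreachable s' : accessible (Kdy inv P) s s' -> ~ sent_states P m s'.
  by move=> ss' s'm; apply: Ksm; exists s'.
pose pi (s' : states P) : set Phi0 := fun=> ~ sent_states P m s'.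
(* Validity at [s] refutes [Know (Prim p)]. Three goals remain: dependence on the message,
   nontriviality, and this knowledge. *)
apply: (secr pi (Prim p) _ _ s) => [s1 s2 m' s1m' s2m'||s' ss'].
(* As the exchanged message is unique, [Prim p] at a state exchanging [m'] amounts to [m' <> m],
   which no longer mentions the state. *)
- have sent_eq (s' : states P) : sent_states P m' s' ->
      sent_states P m s' <-> m' = m.
    move=> s'm'; split=> [s'm|<- //].
    have [m0 [_ m0_uniq]] := exchanged_unique (set_valP s').
    by rewrite -(m0_uniq _ s'm') -(m0_uniq _ s'm).
  by rewrite /= /pi !sent_eq.
- have [t0 t0P t0m] := (messagesP P m).1 mP.
  (* [Prim p] holds at [s], which is accessible from itself, and fails at [t0], which exchanges
     [m]. *)
  exists s, (exist _ t0 (mem_set t0P)); split; first exact: unreachable.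
  by move=> /(_ t0m).
- exact: unreachable.
Qed.
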